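(* Let $p$ be an odd prime, let $q:=p^m$ (with $m\ge1$), and let $G$ be a finite $p$-group of $\mathbb F_q$-Heisenberg type of rank $n$. Then $$m(G)=q^{n+1}\qquad\text{and}\qquad N_{\max}(G)=L_{n,n}(q)=\prod_{i=1}^{n}(q^i+1).$$
   Context: $m(G)$ denotes the maximum order of an abelian subgroup of $G$, and $N_{\max}(G)$ the number of abelian subgroups of $G$ of order $m(G)$. Heisenberg type: for an odd prime $p$ and $q=p^m$, a finite $p$-group $G$ is of $\mathbb F_q$-Heisenberg type of rank $n$ if (i) $G$ has nilpotency class $2$ and exponent $p$; (ii) $G'=Z(G)$ is elementary abelian of order $q$ (so $G'\cong\mathbb F_q$ as additive groups); (iii) $V:=G/Z(G)$ carries the structure of an $\mathbb F_q$-vector space of dimension $2n$ such that, under an identification $G'\cong\mathbb F_q$, the commutator map $\beta:V\times V\to\mathbb F_q$, $\beta(xZ(G),yZ(G))=[x,y]$, is a nondegenerate alternating $\mathbb F_q$-bilinear form. Here $G'$ is the commutator subgroup and $Z(G)$ the center. $L_{n,n}(q)$ is the number of $n$-dimensional totally isotropic (i.e. Lagrangian) $\mathbb F_q$-subspaces of the symplectic space $V$. *)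

(* Defs.v *)
From HB Require Import structures.
From mathcomp Require Import all_boot all_fingroup all_algebra all_solvable.
From mathcomp Require Import sesquilinear.

Set Implicit Arguments.
Unset Strict Implicit.
Unset Printing Implicit Defensive.

Import GRing.Theory.

Section VspaceFinite.
(* The subType structure of {vspace V} is only exported by VectorInternalTheory. *)
Import VectorInternalTheory.
Variables (F : finFieldType) (V : vectType F).
HB.instance Definition _ := [Countable of {vspace V} by <:].
HB.instance Definition _ := [Finite of {vspace V} by <:].
End VspaceFinite.

Definition max_abelian_order (gT : finGroupType) (G : {group gT}) : nat :=
  \max_(A : {group gT} | (A \subset G) && abelian A) #|A|.

Definition num_max_abelian (gT : finGroupType) (G : {group gT}) : nat :=
  #|[set A : {group gT} | [&& A \subset G, abelian A
                            & #|A| == max_abelian_order G]]|.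

(* [orthov beta U] is the beta-orthogonal of U, so [U <= orthov beta U] says
   that beta vanishes on U x U. *)
Definition num_totally_isotropic (F : finFieldType) (V : vectType F)
    (beta : {skew_symmetric V}%R) (k : nat) : nat :=
  #|[set U : {vspace V} | (\dim U == k) && (U <= orthov beta U)%VS]|.

(* The F-vector space structure carried by G / Z(G) is given by transport along
   an isomorphism onto the additive group of a vector space over F.  The type
   [{skew_symmetric V}] of the form only packages F-bilinearity and
   skew-symmetry (which follows from the alternating property). *)
Record heisenberg_type (p : nat) (F : finFieldType) (n : nat)
    (gT : finGroupType) (G : {group gT}) := HeisenbergType {
  heis_nil_class : nil_class G = 2;
  heis_exponent : exponent G = p;
  heis_der : (G^`(1) = 'Z(G))%g;
  heis_center_abelem : (p.-abelem 'Z(G))%g;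
  heis_center_card : #|'Z(G)%g| = #|F|;

  heis_space : vectType F;
  heis_dim : \dim {:heis_space} = n.*2;
  heis_quo : coset_of 'Z(G)%g -> heis_space;
  heis_quoM : {in (G / 'Z(G))%g &,
    {morph heis_quo : x y / (x * y)%g >-> (x + y)%R}};
  heis_quo_inj : {in (G / 'Z(G))%g &, injective heis_quo};
  heis_quo_surj : forall v, exists2 x, x \in (G / 'Z(G))%g & heis_quo x = v;

  heis_val : gT -> F;
  heis_valM : {in (G^`(1))%g &,
    {morph heis_val : x y / (x * y)%g >-> (x + y)%R}};
  heis_val_inj : {in (G^`(1))%g &, injective heis_val};
  heis_val_surj : forall a, exists2 x, x \in (G^`(1))%g & heis_val x = a;

  heis_form : {skew_symmetric heis_space}%R;
  heis_formE : {in G &, forall x y,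
    heis_form (heis_quo (coset 'Z(G)%g x)) (heis_quo (coset 'Z(G)%g y))
      = heis_val [~ x, y]%g};
  heis_form_alt : forall v, heis_form v v = 0%R;
  heis_form_nondeg : nondegenerate heis_form
}.

(* Main.v *)
Require Import Defs.
From HB Require Import structures.
From mathcomp Require Import all_boot all_fingroup all_algebra all_solvable.
From mathcomp Require Import sesquilinear finfield.

(** Let pi : G -> V = G / Z(G) be the projection and q = #|F|.  Two elements of
    G commute exactly when their images are beta-orthogonal, because beta is
    the commutator map.  Hence for an abelian subgroup A of G the vectors pi(A)
    are pairwise orthogonal, and by bilinearity so is their whole F-linear span
    U, even though pi(A) itself need only be an additive subgroup.  Since beta
    is nondegenerate, a totally isotropic U has dimension at most n, and A lies
    in the preimage of U, which has order #|Z(G)| * #|U| = q * q ^ \dim U.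
    Therefore #|A| <= q ^ n.+1, with equality exactly when U is Lagrangian and A
    is its full preimage.  Conversely preimages of totally isotropic subspaces
    are abelian.  As soon as a Lagrangian exists, [U |-> pi^-1(U)] is thus a
    bijection from the Lagrangians onto the abelian subgroups of maximal order
    ([max_abelian_order_heis], [num_max_abelian_heis]).

    The Lagrangians are counted through their ordered bases ([card_lagrangian]).
    A free sequence of i vectors spanning a totally isotropic U extends to a
    longer one by any vector of orthov U outside U, that is in
    q ^ (2n - i) - q ^ i ways, which gives the number of isotropic frames of
    length n.  Each Lagrangian is spanned by the product over i < n of
    q ^ n - q ^ i of them, and the i-th factors of the two products have ratio
    q ^ (n - i) + 1.  The resulting product is positive, which also yields the
    existence of a Lagrangian. *)

Set Implicit Arguments.
Unset Strict Implicit.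
Unset Printing Implicit Defensive.

Import GRing.Theory.

(** * Counting tuples, vectors and ordered bases *)

Section CountingTuples.

Variables (T : finType) (P : pred (seq T)) (c : nat -> nat).

(** If the number of ways to extend an admissible sequence depends only on its
    length, the admissible tuples are counted by a product; this serves both
    for the bases of a subspace and for the isotropic frames. *)
Lemma card_tuple_extend :
    P [::] -> (forall x s, P (x :: s) -> P s) ->
    (forall s, P s -> #|[pred x | P (x :: s)]| = c (size s)) ->
  forall k, #|[set t : k.-tuple T | P t]| = \prod_(i < k) c i.
Proof.
move=> P0 Pbehead cP; elim=> [|k IHk].
  rewrite big_ord0 -(cards1 [tuple of [::] : seq T]).
  by apply: eq_card => t; rewrite !inE tuple0 eqxx; apply: P0.
rewrite big_ord_recr /= -IHk -sum1dep_card.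
rewrite (reindex (fun u : T * k.-tuple T => [tuple of u.1 :: u.2])) /=; last first.
  exists (fun t : k.+1.-tuple T => (thead t, [tuple of behead t]))
    => [[x t] _|t _] /=.
    by congr (_, _); apply: val_inj.
  by rewrite -tuple_eta.
rewrite (eq_bigl (fun u : T * k.-tuple T => P u.2 && P (u.1 :: u.2))) /=; last first.
  by case=> x t; apply/idP/andP=> [Pt | []//]; split=> //; apply: Pbehead Pt.
transitivity (\sum_(t : k.-tuple T | P t) \sum_(x | P (x :: t)) 1).
  rewrite pair_big_dep /= (reindex (fun u : k.-tuple T * T => (u.2, u.1))) //=.
  by exists (fun u => (u.2, u.1)) => -[].
rewrite (eq_bigr (fun=> c k)) => [|t Pt].
  by rewrite sum_nat_const; congr (_ * _); apply: eq_card => t; rewrite inE.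
have := cP t Pt; rewrite size_tuple => <-.
by rewrite sum1dep_card; apply: eq_card => x; rewrite inE.
Qed.

End CountingTuples.

Lemma card_memv (F : finFieldType) (V : vectType F) (U : {vspace V}) :
  #|[pred v : finvect_type V | v \in U]| = #|F| ^ \dim U.
Proof.
(* Only for a [Vector.Pack] is the vector structure of [finvect_type V]
   convertible to that of [V], hence the case analysis. *)
case: V U => T cT U.
exact: (@card_vspace F (finvect_type (Vector.Pack cT)) cT).
Qed.

Lemma card_memvD (F : finFieldType) (V : vectType F) (U W : {vspace V}) :
  (U <= W)%VS ->
  #|[pred v : finvect_type V | (v \in W) && (v \notin U)]|
    = #|F| ^ \dim W - #|F| ^ \dim U.
Proof.
move=> sUW; rewrite -!card_memv.
pose memU := [pred v : finvect_type V | v \in U].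
rewrite -[#|[pred v : finvect_type V | v \in W]|](cardID memU).
rewrite [X in X + _ - _](_ : _ = #|memU|).
  by rewrite addKn; apply: eq_card => v; rewrite !inE andbC.
by apply: eq_card => v; rewrite !inE andb_idl // => /(subvP sUW).
Qed.

Section Bases.
Variables (F : finFieldType) (V : vectType F).
Local Notation fV := (finvect_type V).

Lemma card_bases (U : {vspace V}) (k : nat) :
  \dim U = k -> #|[set t : k.-tuple fV | basis_of U t]|
    = \prod_(i < k) (#|F| ^ k - #|F| ^ i).
Proof.
move=> dimU.
(* When the length is the dimension of U, a free sequence in U spans U. *)
pose P (t : seq V) := free t && all [in U] t.
rewrite -(@card_tuple_extend fV P (fun i => #|F| ^ k - #|F| ^ i)).
- apply: eq_card => t; rewrite !inE /P basisEfree size_tuple dimU leqnn andbT.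
  by congr (_ && _); apply/span_subvP/allP.
- by rewrite /P nil_free.
- by move=> x s; rewrite /P free_cons /= => /and3P[/andP[_ ->] _ ->].
move=> s /andP[free_s /allP/span_subvP sU].
rewrite -dimU -(eqP (free_s : \dim _ == _)) -card_memvD //.
apply: eq_card => x; rewrite !inE /P free_cons free_s andbT /= andbC andbAC.
by move/span_subvP/allP: sU => ->; rewrite andbT.
Qed.

End Bases.

(** * Totally isotropic subspaces of a symplectic space *)

Section Symplectic.
Variables (F : finFieldType) (V : vectType F) (beta : {skew_symmetric V}%R).
Local Notation fV := (finvect_type V).

Lemma orthov_add U W : (orthov beta (U + W) = orthov beta U :&: orthov beta W)%VS.
Proof.
apply/vspaceP => v; rewrite memv_cap !memvE.
by rewrite orthov_sym orthoDv -!(orthov_sym beta <[v]>).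
Qed.

(** Each generator of W imposes one linear condition. *)
Lemma dim_orthov_add U W :
  \dim (orthov beta U) <= \dim (orthov beta (U + W)) + \dim W.
Proof.
suffices add_span s :
    \dim (orthov beta U) <= \dim (orthov beta (U + <<s>>)) + size s.
  by have := add_span (vbasis W); rewrite size_tuple (span_basis (vbasisP W)).
elim: s => [|w s IHs]; first by rewrite span_nil addv0 addn0.
rewrite span_cons (addvC <[w]>%VS) addvA orthov_add /= addnS -addSn.
apply: leq_trans IHs _; rewrite leq_add2r.
by have := leq_dim_orthov1 beta w (orthov beta (U + <<s>>)); case: (\dim _).
Qed.

Hypothesis nondeg : nondegenerate beta.

(** Both inequalities come from [dim_orthov_add]: enlarge 0 to U for the lower
    bound, and enlarge U to the whole space, whose orthogonal vanishes, for the
    upper bound. *)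
Lemma dim_orthov U : \dim (orthov beta U) = \dim {:V} - \dim U.
Proof.
apply/eqP; rewrite eqn_leq; apply/andP; split.
  have := dim_orthov_add U U^C; rewrite addv_complf (eqP nondeg) dimv0.
  by rewrite dimv_compl.
by have := dim_orthov_add 0 U; rewrite orthov0 add0v leq_subLR addnC.
Qed.

Variable n : nat.
Hypothesis dimV : \dim {:V} = n.*2.

Lemma dim_isotropic U : (U <= orthov beta U)%VS -> \dim U <= n.
Proof.
move/dimvS; rewrite dim_orthov leq_subRL ?dimvS ?subvf //.
by rewrite dimV addnn leq_double.
Qed.

Hypothesis alt : forall v, beta v v = 0%R.

Definition isotropic_frame (s : seq V) :=
  free s && (<<s>> <= orthov beta <<s>>)%VS.

Lemma isotropic_cons v (s : seq V) :
  (<<v :: s>> <= orthov beta <<v :: s>>)%VS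
    = (v \in orthov beta <<s>>)%VS && (<<s>> <= orthov beta <<s>>)%VS.
Proof.
rewrite span_cons orthoDv !orthovD orthov11 alt eqxx /=.
by rewrite (orthov_sym beta <<s>>%VS <[v]>%VS) andbA andbb.
Qed.

Lemma card_isotropic_frames k :
  #|[set t : k.-tuple fV | isotropic_frame t]|
    = \prod_(i < k) (#|F| ^ (n.*2 - i) - #|F| ^ i).
Proof.
rewrite -(@card_tuple_extend fV isotropic_frame
  (fun i => #|F| ^ (n.*2 - i) - #|F| ^ i)) //.
- by rewrite /isotropic_frame nil_free span_nil sub0v.
- move=> x s; rewrite /isotropic_frame isotropic_cons free_cons.
  by case/andP=> /andP[_ ->] /andP[_ ->].
move=> s /andP[free_s iso_s].
rewrite -dimV -(eqP (free_s : \dim _ == _)) -dim_orthov -card_memvD //.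
apply: eq_card => x; rewrite !inE /isotropic_frame free_cons isotropic_cons.
by rewrite free_s iso_s !andbT andbC.
Qed.

(** Dividing the number of isotropic frames by the number of bases of one
    Lagrangian can be done factor by factor. *)
Lemma frame_ratio q i : 0 < q -> i <= n ->
  q ^ (n.*2 - i) - q ^ i = (q ^ (n - i) + 1) * (q ^ n - q ^ i).
Proof.
move=> q_gt0 le_i_n; rewrite mulnDl mul1n mulnBr -!expnD subnK //.
have le_qi_qn : q ^ i <= q ^ n by rewrite leq_pexp2l.
rewrite addnBA // addnC.
have -> : n - i + n = n.*2 - i by rewrite -addnn addnBAC.
have le_qn_qm : q ^ n <= q ^ (n.*2 - i).
  by rewrite leq_pexp2l // -addnn -addnBA // leq_addr.
by rewrite addnBA // addKn.
Qed.

(** Mapping an isotropic frame of length n to its span partitions these frames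
    into the sets of bases of the Lagrangians. *)
Lemma card_lagrangian :
  num_totally_isotropic beta n = \prod_(1 <= i < n.+1) (#|F| ^ i + 1).
Proof.
have F_gt1 := finNzRing_gt1 F.
pose b := \prod_(i < n) (#|F| ^ n - #|F| ^ i).
have b_gt0 : 0 < b by apply: prodn_gt0 => i; rewrite subn_gt0 ltn_exp2l.
apply/eqP; rewrite -(eqn_pmul2r b_gt0); apply/eqP.
transitivity (\prod_(i < n) (#|F| ^ (n.*2 - i) - #|F| ^ i)).
  rewrite -card_isotropic_frames -sum1_card.
  rewrite (partition_big (fun t : n.-tuple fV => <<(t : seq V)>>%VS)
    (fun U => (\dim U == n) && (U <= orthov beta U)%VS)) /=; last first.
    move=> t; rewrite inE => /andP[/eqP-> ->].
    by rewrite size_tuple eqxx.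
  rewrite (eq_bigr (fun=> b)) => [|U /andP[/eqP dimU isoU]].
    rewrite sum_nat_const; congr (_ * _).
    by apply: eq_card => U; rewrite inE.
  rewrite /b -(card_bases dimU) sum1dep_card; apply: eq_card => t; rewrite !inE.
  rewrite /isotropic_frame /basis_of andbAC andb_idr.
    by rewrite andbC.
  by case/andP=> _ /eqP->.
rewrite big_add1 /= big_mkord [X in _ = X * _](reindex_inj rev_ord_inj) -big_split /=.
apply: eq_bigr => i _; rewrite subnSK ?ltn_ord //.
by rewrite frame_ratio // ltnW.
Qed.

End Symplectic.

(** * Abelian subgroups of a group of Heisenberg type *)

Section HeisenbergGroup.
Variables (p n : nat) (F : finFieldType) (gT : finGroupType) (G : {group gT}).
Variable H : heisenberg_type p F n G.

Local Notation V := (heis_space H).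
Local Notation beta := (heis_form H).
Local Open Scope group_scope.

Definition heis_vec (x : gT) : V := heis_quo H (coset 'Z(G) x).

Lemma heis_vecM : {in G &, {morph heis_vec : x y / x * y >-> (x + y)%R}}.
Proof.
have nZG := subsetP (normal_norm (center_normal G)).
move=> x y Gx Gy; rewrite /heis_vec morphM ?nZG // heis_quoM //.
  exact: mem_quotient.
exact: mem_quotient.
Qed.

Lemma heis_vec1 : heis_vec 1 = 0%R.
Proof. by apply: (@addrI _ (heis_vec 1)); rewrite -heis_vecM // mulg1 addr0. Qed.

Lemma heis_vec_onto v : exists2 x, x \in G & heis_vec x = v.
Proof.
by have [_ /morphimP[x _ Gx ->] <-] := heis_quo_surj v; exists x.
Qed.

Lemma heis_val1 : heis_val H 1 = 0%R.
Proof. by apply: (@addrI _ (heis_val H 1)); rewrite -heis_valM // mulg1 addr0. Qed.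

Lemma commute_heis_vec x y : x \in G -> y \in G ->
  reflect (commute x y) (beta (heis_vec x) (heis_vec y) == 0%R).
Proof.
move=> Gx Gy; rewrite heis_formE //.
apply: (iffP eqP) => [xy0 | /commgP/eqP->]; last exact: heis_val1.
apply/commgP/eqP/(heis_val_inj (h := H)); rewrite ?heis_val1 //.
exact: mem_commg.
Qed.

Definition heis_preim (U : {vspace V}) : {set gT} := [set x in G | heis_vec x \in U].

Lemma heis_preim_group_set U : group_set (heis_preim U).
Proof.
apply/group_setP; split=> [|x y]; first by rewrite inE group1 heis_vec1 mem0v.
rewrite !inE => /andP[Gx Ux] /andP[Gy Uy].
by rewrite groupM // heis_vecM // memvD.
Qed.
Canonical heis_preim_group U := Group (heis_preim_group_set U).

Lemma heis_preim_sub U : heis_preim U \subset G.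
Proof. by apply/subsetP => x; rewrite inE => /andP[]. Qed.

Lemma sub_center_heis_preim U : 'Z(G) \subset heis_preim U.
Proof.
apply/subsetP => z Zz; rewrite inE (subsetP (center_sub G)) //=.
have -> : heis_vec z = heis_vec 1 by rewrite /heis_vec !coset_id.
by rewrite heis_vec1 mem0v.
Qed.

(** The preimage is a union of cosets of the center, one for each vector
    of U. *)
Lemma card_heis_preim U : #|heis_preim U| = (#|F| ^ (\dim U).+1)%N.
Proof.
have sZU := sub_center_heis_preim U.
rewrite -(Lagrange sZU) (heis_center_card H) expnS; congr (_ * _)%N.
rewrite -card_quotient; last first.
  exact: subset_trans (heis_preim_sub U) (normal_norm (center_normal G)).
have quo_inj : {in heis_preim U / 'Z(G) &,
    injective (heis_quo H : _ -> finvect_type V)}.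
  apply: sub_in2 (heis_quo_inj (h := H)).
  exact/subsetP/quotientS/heis_preim_sub.
rewrite -(card_in_imset quo_inj) -card_memv; apply: eq_card => v.
rewrite !inE; apply/imsetP/idP => [[_ /morphimP[x _ Ux ->] ->] | Uv].
  by move: Ux; rewrite inE => /andP[].
have [x Gx vx] := heis_vec_onto v; exists (coset 'Z(G) x) => //.
by rewrite mem_quotient // inE Gx vx.
Qed.

Lemma heis_preim_inj : injective heis_preim_group.
Proof.
move=> U W /(congr1 val)/= /setP eqUW; apply/vspaceP => v.
by have [x Gx <-] := heis_vec_onto v; have := eqUW x; rewrite !inE Gx.
Qed.

Lemma abelian_heis_preim U :
  (U <= orthov beta U)%VS -> abelian (heis_preim U).
Proof.
move/orthovP=> isoU; apply/centsP => x + y.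
rewrite !inE => /andP[Gx Ux] /andP[Gy Uy].
by apply/commute_heis_vec => //; rewrite isoU.
Qed.

(** The image of an abelian subgroup of G is only an additive subgroup of V;
    passing to its F-span puts the subgroup inside the preimage of a
    subspace. *)
Definition heis_span (A : {set gT}) : {vspace V} := <<[seq heis_vec x | x in A]>>%VS.

Lemma sub_heis_preim_span (A : {set gT}) :
  A \subset G -> A \subset heis_preim (heis_span A).
Proof.
move/subsetP=> sAG; apply/subsetP => x Ax.
by rewrite inE sAG // memv_span // image_f.
Qed.

Lemma isotropic_heis_span (A : {set gT}) :
  A \subset G -> abelian A -> (heis_span A <= orthov beta (heis_span A))%VS.
Proof.
move/subsetP=> sAG /centsP cAA; apply/span_subvP => _ /imageP[x Ax ->].
rewrite mem_orthov_sym; apply/span_subvP => _ /imageP[y Ay ->].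
by rewrite mem_orthov1; apply/commute_heis_vec; rewrite ?sAG //; apply: cAA.
Qed.

Lemma dim_heis_span (A : {set gT}) :
  A \subset G -> abelian A -> \dim (heis_span A) <= n.
Proof.
move=> sAG cAA; apply: (dim_isotropic (heis_form_nondeg H) (heis_dim H)).
exact: isotropic_heis_span.
Qed.

Lemma card_abelian_heis (A : {set gT}) :
  A \subset G -> abelian A -> #|A| <= (#|F| ^ n.+1)%N.
Proof.
move=> sAG cAA; apply: leq_trans (subset_leq_card (sub_heis_preim_span sAG)) _.
by rewrite card_heis_preim leq_exp2l ?finNzRing_gt1 // ltnS dim_heis_span.
Qed.

(** The bound is attained at the preimage of a Lagrangian, which exists because
    the number of Lagrangians is a positive product. *)
Lemma max_abelian_order_heis : max_abelian_order G = (#|F| ^ n.+1)%N.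
Proof.
apply/eqP; rewrite eqn_leq; apply/andP; split.
  by apply/bigmax_leqP => A /andP[sAG cAA]; apply: card_abelian_heis.
have : 0 < num_totally_isotropic beta n.
  rewrite (card_lagrangian (heis_form_nondeg H) (heis_dim H)); last first.
    exact: heis_form_alt.
  by apply: prodn_gt0 => i; rewrite addn1.
case/card_gt0P => U; rewrite inE => /andP[/eqP dimU isoU].
rewrite -dimU -card_heis_preim.
apply: (leq_bigmax_cond (heis_preim_group U)).
by rewrite heis_preim_sub abelian_heis_preim.
Qed.

(** An abelian A of order #|F| ^ n.+1 fills the preimage of its span, whose
    dimension is then forced to be n. *)
Lemma num_max_abelian_heis : num_max_abelian G = num_totally_isotropic beta n.
Proof.
rewrite /num_totally_isotropic -(card_imset _ heis_preim_inj).
apply: eq_card => A; rewrite inE max_abelian_order_heis.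
apply/and3P/imsetP => [[sAG cAA /eqP oA] | [U + ->]]; last first.
  rewrite inE => /andP[/eqP dimU isoU].
  by rewrite heis_preim_sub abelian_heis_preim // card_heis_preim dimU.
exists (heis_span A); last first.
  apply/group_inj/eqP; rewrite eqEcard sub_heis_preim_span // oA.
  by rewrite card_heis_preim leq_exp2l ?finNzRing_gt1 // ltnS dim_heis_span.
rewrite inE isotropic_heis_span // andbT eqn_leq dim_heis_span //=.
have := subset_leq_card (sub_heis_preim_span sAG).
by rewrite oA card_heis_preim leq_exp2l ?finNzRing_gt1.
Qed.

End HeisenbergGroup.

Theorem corollary7p16 (p m n : nat) (F : finFieldType)
    (gT : finGroupType) (G : {group gT}) (H : heisenberg_type p F n G) :
  prime p -> odd p -> 0 < m -> #|F| = p ^ m -> (p.-group G)%g ->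
  let q := p ^ m in
  [/\ max_abelian_order G = q ^ n.+1,
      num_max_abelian G = num_totally_isotropic (heis_form H) n
    & num_totally_isotropic (heis_form H) n = \prod_(1 <= i < n.+1) (q ^ i + 1)].
Proof.
move=> _ _ _ <- _ /=; split.
- exact: max_abelian_order_heis H.
- exact: num_max_abelian_heis.
- apply: card_lagrangian; first exact: heis_form_nondeg.
    exact: heis_dim.
  exact: heis_form_alt.
Qed.
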